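(* Let $M$ be an infinite complete metric space with base point $0$, and let $f:M\to M$ be a Lipschitz map with $f(0)=0$. If $\gamma\in\mathcal{F}(M)$ is a supercyclic vector for the Lipschitz operator $\widehat{f}:\mathcal{F}(M)\to\mathcal{F}(M)$, then $\gamma$ is infinitely supported, i.e. the support of $\gamma$ is infinite.
   Context: For a metric space $(M,d)$ with base point $0$, $\mathrm{Lip}_0(M)$ is the real Banach space of Lipschitz functions $M\to\mathbb{R}$ vanishing at $0$, with norm the best Lipschitz constant. For $x\in M$, $\delta(x)\in \mathrm{Lip}_0(M)^*$ is the evaluation $\langle \varphi,\delta(x)\rangle=\varphi(x)$. The Lipschitz-free space is $\mathcal{F}(M)=\overline{\mathrm{span}}^{\|\cdot\|}\{\delta(x):x\in M\}\subset \mathrm{Lip}_0(M)^*$. If $f:M\to M$ is Lipschitz with $f(0)=0$, $\widehat{f}:\mathcal{F}(M)\to\mathcal{F}(M)$ is the unique bounded linear operator with $\widehat{f}(\delta(x))=\delta(f(x))$ for all $x\in M$. A vector $\gamma$ is supercyclic for a bounded operator $T$ on a real Banach space $X$ if $\{\lambda T^n\gamma:\lambda\in\mathbb{R},\,n\ge0\}$ is dense in $X$. For a closed $K\subset M$ with $0\in K$, $\mathcal{F}(K)$ is identified with $\overline{\mathrm{span}}\{\delta(x):x\in K\}\subset\mathcal{F}(M)$. The support of $\gamma\in\mathcal{F}(M)$ is the intersection of all closed subsets $K$ of $M$ (containing $0$) such that $\gamma\in\mathcal{F}(K)$; it is known that $\gamma\in\mathcal{F}(\mathrm{supp}\,\gamma)$.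 An element $\gamma$ is finitely supported if $\gamma\in\mathrm{span}\{\delta(x):x\in M\}$ (equivalently, its support is finite), and infinitely supported otherwise. *)

(* Defs.v *)
From HB Require Import structures.
From mathcomp Require Import all_boot all_order all_algebra.
From mathcomp Require Import all_classical all_reals all_analysis.

Set Implicit Arguments.
Unset Strict Implicit.
Unset Printing Implicit Defensive.

Import Order.TTheory GRing.Theory Num.Theory.
Import numFieldNormedType.Exports.

Local Open Scope classical_set_scope.
Local Open Scope ring_scope.

(* The completeness mixin of the library comes with a distinguished point, which
   is not used below: base points are always given explicitly. *)
#[short(type="completeMetricType")]
HB.structure Definition CompleteMetric (K : numDomainType) :=
  { M of Metric K M & Uniform_isComplete M & isPointed M }.

Section BestConstant.
Context {R : realType} {I : Type}.
Implicit Types (a b : I -> R).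

Definition admissible a b : set R :=
  [set k | 0 <= k /\ forall i, a i <= k * b i].

(* Common shape of the operator norm and of the best Lipschitz constant: the
   least k >= 0 with a i <= k * b i for all i. It is attained as soon as some k is
   admissible; see best_constantP. *)
Definition best_constant a b : R := inf (admissible a b).

Lemma best_constant_lbound a b : has_lbound (admissible a b).
Proof. by exists 0 => k []. Qed.

Lemma best_constant_le a b k : admissible a b k -> best_constant a b <= k.
Proof. by move=> abk; apply: ge_inf => //; exact: best_constant_lbound. Qed.

Lemma best_constantP a b : (forall i, 0 <= b i) -> admissible a b !=set0 ->
  admissible a b (best_constant a b).
Proof.
move=> b0 ab0; split; first by apply: lb_le_inf => // k [].
move=> i; apply/ler_addgt0Pr => e e0.
have b1 : 0 < b i + 1 by rewrite ltr_wpDl.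
have [k [_ /(_ i) ak] kl] := inf_adherent (divr_gt0 e0 b1)
  (conj ab0 (best_constant_lbound a b)).
apply: (le_trans ak); apply: (le_trans (ler_wpM2r (b0 i) (ltW kl))).
rewrite mulrDl lerD2l mulrAC ler_pdivrMr// ler_wpM2l ?ltW//.
by rewrite ltrDl.
Qed.

End BestConstant.

Section BoundedOperators.
Context {R : realType}.

Definition bounded_operator {X Y : normedModType R} : {pred X -> Y} :=
  fun T => `[< linear T /\ exists k, forall v, `|T v| <= k * `|v| >].

Record boundedOp (X Y : normedModType R) := BoundedOp {
  boundedOp_fun :> X -> Y;
  _ : boundedOp_fun \in bounded_operator
}.

Section Instances.
Variables X Y : normedModType R.

HB.instance Definition _ := [isSub for @boundedOp_fun X Y].
HB.instance Definition _ := [Choice of boundedOp X Y by <:].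

Lemma bounded_operator_submod_closed :
  submod_closed (@bounded_operator X Y : {pred X -> Y}).
Proof.
split.
  apply/asboolP; split; first by move=> a u v /=; rewrite scaler0 addr0.
  by exists 0 => v; rewrite normr0 mul0r.
move=> a S T /asboolP[linS [k Sk]] /asboolP[linT [l Tl]].
apply/asboolP; split.
  move=> b u v; rewrite !fctE/= linS linT !scalerDr !scalerA [b * a]mulrC.
  by rewrite addrACA.
exists (`|a| * k + l) => v; rewrite !fctE/= (le_trans (ler_normD _ _))// mulrDl.
by rewrite lerD// normrZ -mulrA ler_wpM2l.
Qed.

HB.instance Definition _ := GRing.isSubmodClosed.Build R (X -> Y)
  (@bounded_operator X Y) bounded_operator_submod_closed.
HB.instance Definition _ := [SubChoice_isSubLmodule of boundedOp X Y by <:].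

Lemma boundedOp_linear (T : boundedOp X Y) : linear T.
Proof. by case: T => T /= /asboolP[]. Qed.

HB.instance Definition _ (T : boundedOp X Y) :=
  GRing.isLinear.Build R X Y *:%R T (boundedOp_linear T).

Definition boundedOp_norm (T : boundedOp X Y) : R :=
  best_constant (fun v => `|T v|) (fun v => `|v|).

Lemma boundedOp_normP (T : boundedOp X Y) :
  admissible (fun v => `|T v|) (fun v => `|v|) (boundedOp_norm T).
Proof.
apply: best_constantP => //; case: T => T /= /asboolP[_ [k Tk]].
exists `|k|; split=> // v; rewrite (le_trans (Tk v))// ler_wpM2r//.
exact: ler_norm.
Qed.

Lemma boundedOp_normD (S T : boundedOp X Y) :
  boundedOp_norm (S + T) <= boundedOp_norm S + boundedOp_norm T.
Proof.
have [S0 Sk] := boundedOp_normP S; have [T0 Tk] := boundedOp_normP T.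
apply: best_constant_le; split; first exact: addr_ge0.
move=> v; rewrite (le_trans (ler_normD _ _))// mulrDl.
by apply: lerD; [exact: Sk|exact: Tk].
Qed.

Lemma boundedOp_normZ_le (l : R) (T : boundedOp X Y) :
  boundedOp_norm (l *: T) <= `|l| * boundedOp_norm T.
Proof.
have [T0 Tk] := boundedOp_normP T.
apply: best_constant_le; split; first exact: mulr_ge0.
by move=> v; rewrite normrZ -mulrA ler_wpM2l//; exact: Tk.
Qed.

Lemma boundedOp_normZ (l : R) (T : boundedOp X Y) :
  boundedOp_norm (l *: T) = `|l| * boundedOp_norm T.
Proof.
apply/eqP; rewrite eq_le boundedOp_normZ_le/=.
have [->|l0] := eqVneq l 0.
  by rewrite normr0 mul0r; case: (boundedOp_normP (0 *: T)).
rewrite -ler_pdivlMl ?normr_gt0// -normfV.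
by rewrite -[in leLHS](scalerK l0 T) boundedOp_normZ_le.
Qed.

Lemma boundedOp_norm0_eq0 (T : boundedOp X Y) : boundedOp_norm T = 0 -> T = 0.
Proof.
have [_ Tk] := boundedOp_normP T => T0; apply/val_inj/funext => v /=.
by apply/eqP; rewrite -normr_le0 (le_trans (Tk v))// T0 mul0r.
Qed.

HB.instance Definition _ := Lmodule_isNormed.Build R (boundedOp X Y)
  boundedOp_normD boundedOp_normZ boundedOp_norm0_eq0.

Lemma boundedOp_le_norm (T : boundedOp X Y) v : `|T v| <= `|T| * `|v|.
Proof. by have [_] := boundedOp_normP T. Qed.

End Instances.

Definition dual_space (X : normedModType R) := boundedOp X R^o.

HB.instance Definition _ (X : normedModType R) :=
  NormedModule.on (dual_space X).

Definition supercyclic {X : normedModType R} (T : boundedOp X X) (g : X) :=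
  dense [set w | exists l n, w = l *: iter n T g].

End BoundedOperators.

Section Span.
Context {R : realType} {X : normedModType R}.

Definition lin_span (A : set X) : set X :=
  [set v | exists n (a : 'I_n -> R) (x : 'I_n -> X),
     (forall i, A (x i)) /\ v = \sum_(i < n) a i *: x i].

Lemma closure_normP (A : set X) (v : X) :
  closure A v <-> forall e, 0 < e -> exists2 u, A u & `|v - u| < e.
Proof.
split=> [Av e e0|Av B /nbhs_normP[e e0 eB]].
  have [u [Au vu]] := Av _ (nbhsx_ballx v e e0); exists u => //.
  by move: vu; rewrite -ball_normE.
by have [u Au vu] := Av _ e0; exists u; split => //; exact: eB.
Qed.

Lemma span0 (A : set X) : lin_span A 0.
Proof.
by exists 0%N, (fun=> 0), (fun=> 0); split; [case|rewrite big_ord0].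
Qed.

Lemma spanZD (A : set X) a u v :
  lin_span A u -> lin_span A v -> lin_span A (a *: u + v).
Proof.
move=> [n [b [x [Ax ->]]]] [m [c [y [Ay ->]]]].
exists (n + m)%N,
  (fun i : 'I_(n + m) => match fintype.split i with
     inl j => a * b j | inr j => c j end),
  (fun i : 'I_(n + m) => match fintype.split i with
     inl j => x j | inr j => y j end).
split=> [i|]; first by case: (fintype.split i).
rewrite big_split_ord/= scaler_sumr; congr (_ + _); apply: eq_bigr => i _.
  by rewrite (unsplitK (inl i)) scalerA.
by rewrite (unsplitK (inr i)).
Qed.

Lemma sub_span (A : set X) : A `<=` lin_span A.
Proof.
move=> x Ax; exists 1%N, (fun=> 1), (fun=> x); split=> //.
by rewrite big_ord1 scale1r.
Qed.

Lemma closure_spanZD (A : set X) a u v :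
  closure (lin_span A) u -> closure (lin_span A) v ->
  closure (lin_span A) (a *: u + v).
Proof.
move=> /closure_normP Au /closure_normP Av; apply/closure_normP => e e0.
have a1 : 0 < `|a| + 1 by rewrite ltr_wpDl.
have e2 : 0 < e / 2 by rewrite divr_gt0.
have [u' Au' uu'] := Au _ (divr_gt0 e2 a1); have [v' Av' vv'] := Av _ e2.
exists (a *: u' + v'); first exact: spanZD.
rewrite opprD addrACA -scalerBr (le_lt_trans (ler_normD _ _))//.
rewrite [ltRHS](splitr e) ler_ltD// normrZ.
rewrite (le_trans (ler_wpM2l (normr_ge0 a) (ltW uu')))//.
by rewrite mulrCA ler_piMr ?(ltW e2)// ler_pdivrMr// mul1r lerDl.
Qed.

End Span.

Section LipschitzFunctions.
Context {R : realType} {M : metricType R}.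

(* The library's lipschitz is restricted to normed modules. *)
Definition lipschitz_map {N : metricType R} (f : M -> N) :=
  exists k, forall x y, mdist (f x) (f y) <= k * mdist x y.

Variable x0 : M.

Definition lip0 : {pred M -> R^o} :=
  fun f => `[< f x0 = 0 /\ lipschitz_map f >].

Record Lip0 := MkLip0 { Lip0_fun :> M -> R^o; _ : Lip0_fun \in lip0 }.

HB.instance Definition _ := [isSub for Lip0_fun].
HB.instance Definition _ := [Choice of Lip0 by <:].

Lemma lip0_submod_closed : submod_closed lip0.
Proof.
split.
  apply/asboolP; split => //; exists 0 => x y.
  by rewrite mul0r mdistxx.
move=> a f g /asboolP[f0 [k fk]] /asboolP[g0 [l gl]].
apply/asboolP; split; first by rewrite !fctE f0 g0 scaler0 addr0.
exists (`|a| * k + l) => x y; rewrite !fctE/= mulrDl.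
rewrite [leLHS](_ : _ = `|a * (f y - f x) + (g y - g x)|); last first.
  by rewrite mulrBr addrACA -opprD.
rewrite (le_trans (ler_normD _ _))//; apply: lerD; last exact: gl.
by rewrite normrM -mulrA ler_wpM2l//; exact: fk.
Qed.

HB.instance Definition _ := GRing.isSubmodClosed.Build R (M -> R^o)
  lip0 lip0_submod_closed.
HB.instance Definition _ := [SubChoice_isSubLmodule of Lip0 by <:].

Definition Lip0_norm (f : Lip0) : R :=
  best_constant (fun p : M * M => `|f p.1 - f p.2|) (fun p => mdist p.1 p.2).

Lemma Lip0_base (f : Lip0) : f x0 = 0.
Proof. by case: f => f /= /asboolP[]. Qed.

Lemma Lip0_normP (f : Lip0) :
  admissible (fun p : M * M => `|f p.1 - f p.2|) (fun p => mdist p.1 p.2)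
    (Lip0_norm f).
Proof.
apply: best_constantP => [p|]; first exact: mdist_ge0.
case: f => f /= /asboolP[_ [k fk]]; exists `|k|; split=> // -[x y] /=.
rewrite distrC (le_trans (fk x y))// ler_wpM2r ?mdist_ge0//.
exact: ler_norm.
Qed.

Lemma Lip0_normD (f g : Lip0) : Lip0_norm (f + g) <= Lip0_norm f + Lip0_norm g.
Proof.
have [f0 fk] := Lip0_normP f; have [g0 gk] := Lip0_normP g.
apply: best_constant_le; split; first exact: addr_ge0.
move=> p; rewrite [leLHS](_ : _ = `|(f p.1 - f p.2) + (g p.1 - g p.2)|).
  by rewrite (le_trans (ler_normD _ _))// mulrDl; apply: lerD;
    [exact: fk|exact: gk].
by rewrite addrACA -opprD.
Qed.

Lemma Lip0_normZ_le (l : R) (f : Lip0) :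
  Lip0_norm (l *: f) <= `|l| * Lip0_norm f.
Proof.
have [f0 fk] := Lip0_normP f.
apply: best_constant_le; split; first exact: mulr_ge0.
move=> p; rewrite [leLHS](_ : _ = `|l * (f p.1 - f p.2)|).
  by rewrite normrM -mulrA ler_wpM2l//; exact: fk.
by rewrite mulrBr.
Qed.

Lemma Lip0_normZ (l : R) (f : Lip0) : Lip0_norm (l *: f) = `|l| * Lip0_norm f.
Proof.
apply/eqP; rewrite eq_le Lip0_normZ_le/=.
have [->|l0] := eqVneq l 0.
  by rewrite normr0 mul0r; case: (Lip0_normP (0 *: f)).
rewrite -ler_pdivlMl ?normr_gt0// -normfV.
by rewrite -[in leLHS](scalerK l0 f) Lip0_normZ_le.
Qed.

Lemma Lip0_norm0_eq0 (f : Lip0) : Lip0_norm f = 0 -> f = 0.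
Proof.
have [_ fk] := Lip0_normP f => f0; apply/val_inj/funext => x /=.
apply/eqP; rewrite -normr_le0; have := fk (x, x0).
by rewrite /= Lip0_base subr0 f0 mul0r.
Qed.

HB.instance Definition _ := Lmodule_isNormed.Build R Lip0
  Lip0_normD Lip0_normZ Lip0_norm0_eq0.

Lemma Lip0_le_norm (f : Lip0) x y : `|f x - f y| <= `|f| * mdist x y.
Proof. by have [_ /(_ (x, y))] := Lip0_normP f. Qed.

End LipschitzFunctions.

Section LipschitzFree.
Context {R : realType} {M : metricType R} (x0 : M).

Lemma evaluation_subproof (x : M) :
  (fun f : Lip0 x0 => f x) \in @bounded_operator R (Lip0 x0) R^o.
Proof.
apply/asboolP; split=> //; exists (mdist x x0) => f.
by rewrite -[f x]subr0 -(Lip0_base f) mulrC Lip0_le_norm.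
Qed.

Definition evaluation (x : M) : dual_space (Lip0 x0) :=
  BoundedOp (evaluation_subproof x).

Definition in_free : {pred dual_space (Lip0 x0)} :=
  fun m => `[< closure (lin_span (range evaluation)) m >].

Record lipschitz_free := LipschitzFree {
  free_val : dual_space (Lip0 x0);
  _ : free_val \in in_free
}.

HB.instance Definition _ := [isSub for free_val].
HB.instance Definition _ := [Choice of lipschitz_free by <:].

Lemma in_free_submod_closed : submod_closed in_free.
Proof.
split; first by apply/asboolP/subset_closure/span0.
move=> a u v /asboolP Fu /asboolP Fv; apply/asboolP.
exact: closure_spanZD.
Qed.

HB.instance Definition _ := GRing.isSubmodClosed.Build R (dual_space (Lip0 x0))
  in_free in_free_submod_closed.
HB.instance Definition _ := [SubChoice_isSubLmodule of lipschitz_free by <:].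

Definition free_norm (m : lipschitz_free) : R := `|free_val m|.

Lemma free_normD (m n : lipschitz_free) :
  free_norm (m + n) <= free_norm m + free_norm n.
Proof. exact: ler_normD. Qed.

Lemma free_normZ (l : R) (m : lipschitz_free) :
  free_norm (l *: m) = `|l| * free_norm m.
Proof. exact: normrZ. Qed.

Lemma free_norm0_eq0 (m : lipschitz_free) : free_norm m = 0 -> m = 0.
Proof. by move=> /normr0_eq0 m0; exact/val_inj. Qed.

HB.instance Definition _ := Lmodule_isNormed.Build R lipschitz_free
  free_normD free_normZ free_norm0_eq0.

Lemma delta_subproof (x : M) : evaluation x \in in_free.
Proof. by apply/asboolP/subset_closure/sub_span; exists x. Qed.

Definition delta (x : M) : lipschitz_free := LipschitzFree (delta_subproof x).

(* F(K) as a subspace of F(M): since F(M) is closed in the dual of Lip_0(M), the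
   closure may be taken inside F(M). *)
Definition free_on (K : set M) : set lipschitz_free :=
  closure (lin_span (delta @` K)).

Definition free_support (g : lipschitz_free) : set M :=
  \bigcap_(K in [set K : set M | [/\ closed K, K x0 & free_on K g]]) K.

Definition finitely_supported (g : lipschitz_free) := lin_span (range delta) g.

Definition infinitely_supported (g : lipschitz_free) := ~ finitely_supported g.

Definition is_linearization (f : M -> M)
    (T : boundedOp lipschitz_free lipschitz_free) :=
  forall x, T (delta x) = delta (f x).

Section Linearization.
Variable f : M -> M.
Hypotheses (f_lip : lipschitz_map f) (f0 : f x0 = x0).

Lemma comp_lip0_subproof (u : Lip0 x0) : u \o f \in lip0 x0.
Proof.
have [k fk] := f_lip.
apply/asboolP; split; first by rewrite /= f0 Lip0_base.
exists (`|u| * k) => x y; rewrite /= /mdist/= distrC.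
by rewrite (le_trans (Lip0_le_norm _ _ _))// -mulrA ler_wpM2l.
Qed.

Let comp_lip0 (u : Lip0 x0) : Lip0 x0 := MkLip0 (comp_lip0_subproof u).

Lemma comp_lip0_bound :
  exists2 k, 0 <= k & forall u, `|comp_lip0 u| <= k * `|u|.
Proof.
have [k fk] := f_lip; exists `|k| => // u.
apply: best_constant_le; split; first exact: mulr_ge0.
move=> [x y] /=; rewrite (le_trans (Lip0_le_norm _ _ _))// mulrAC mulrC.
rewrite ler_wpM2r// (le_trans (fk _ _))// ler_wpM2r ?mdist_ge0//.
exact: ler_norm.
Qed.

Lemma pullback_subproof (m : dual_space (Lip0 x0)) :
  m \o comp_lip0 \in @bounded_operator R (Lip0 x0) R^o.
Proof.
have [k k0 fk] := comp_lip0_bound.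
apply/asboolP; split=> [a u v|].
  rewrite /= -[RHS](linearP m); congr (m _); exact/val_inj.
exists (`|m| * k) => u /=; rewrite (le_trans (boundedOp_le_norm _ _))//.
by rewrite -mulrA ler_wpM2l.
Qed.

Let pullback (m : dual_space (Lip0 x0)) : dual_space (Lip0 x0) :=
  BoundedOp (pullback_subproof m).

Let pullbackP : linear pullback.
Proof. by move=> a u v; exact/val_inj. Qed.

Lemma pullback_bound :
  exists2 k, 0 < k & forall m, `|pullback m| <= k * `|m|.
Proof.
have [k k0 fk] := comp_lip0_bound; exists (k + 1) => [|m].
  by rewrite ltr_wpDl.
apply: best_constant_le; split; first by rewrite mulr_ge0// addr_ge0.
move=> u /=; rewrite (le_trans (boundedOp_le_norm _ _))//.
rewrite -[leRHS]mulrA [leRHS]mulrCA ler_wpM2l// (le_trans (fk _))//.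
by rewrite ler_wpM2r// lerDl.
Qed.

Lemma pullback_free m : m \in in_free -> pullback m \in in_free.
Proof.
move=> /asboolP/closure_normP mF; apply/asboolP/closure_normP => e e0.
have [k k0 pk] := pullback_bound.
have [_ [n [a [x [xF ->]]]] mu] := mF _ (divr_gt0 e0 k0).
exists (pullback (\sum_(i < n) a i *: x i)).
  exists n, a, (pullback \o x); split=> [i|].
    have [y _ yx] := xF i; exists (f y) => //; rewrite /= -yx.
    exact/val_inj.
  pose P := GRing.isLinear.Build R _ _ *:%R pullback pullbackP.
  pose L : {linear dual_space (Lip0 x0) -> dual_space (Lip0 x0)} :=
    HB.pack pullback P.
  rewrite -[LHS]/(L _) linear_sum; apply: eq_bigr => i _.
  by rewrite linearZ.
have -> : pullback m - pullback (\sum_(i < n) a i *: x i) =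
    pullback (m - \sum_(i < n) a i *: x i).
  exact/val_inj.
by rewrite (le_lt_trans (pk _))// -ltr_pdivlMl// mulrC.
Qed.

Lemma linearization_unique S T :
  is_linearization f S -> is_linearization f T -> S = T.
Proof.
move=> Sf Tf; apply/val_inj/funext => m /=.
have ST n (a : 'I_n -> R) (x : 'I_n -> lipschitz_free) :
    (forall i, range delta (x i)) ->
    S (\sum_(i < n) a i *: x i) = T (\sum_(i < n) a i *: x i).
  move=> xd; rewrite !linear_sum; apply: eq_bigr => i _; rewrite !linearZ.
  congr (_ *: _); have [y _ <-] := xd i; exact: etrans (Sf y) (esym (Tf y)).
have dF : closure (lin_span (range delta)) m.
  apply/closure_normP => e e0; case: m => m mF.
  have /asboolP/closure_normP/(_ _ e0)[_ [n [a [x [xF ->]]]] mu] := mF.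
  have /choice[y yx] : forall i, exists y, evaluation y = x i.
    by move=> i; have [y] := xF i; exists y.
  exists (\sum_(i < n) a i *: delta (y i)).
    by exists n, a, (delta \o y); split=> // i; exists (y i).
  rewrite [ltLHS](_ : _ = `|m - \sum_(i < n) a i *: x i|)//.
  congr (`| m - _ |).
  rewrite (raddf_sum (val : lipschitz_free -> dual_space (Lip0 x0)))/=.
  by apply: eq_bigr => i _; rewrite -yx.
apply/eqP; rewrite -subr_eq0 -normr_le0; apply/ler_addgt0Pr => e e0.
rewrite add0r.
have ST1 : 0 < `|S| + `|T| + 1 by rewrite ltr_wpDl// addr_ge0.
have /closure_normP/(_ _ (divr_gt0 e0 ST1))[_ [n [a [x [xd ->]]]] mu] := dF.
set u := \sum_(i < n) _ in mu.
have STu : S u = T u := ST _ _ _ xd.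
have -> : S m - T m = S (m - u) - T (m - u).
  have SB : S (m - u) = S m - S u := linearB S m u.
  have TB : T (m - u) = T m - T u := linearB T m u.
  rewrite SB TB STu opprD opprK addrACA [- _ + _]addrC.
  by rewrite subrr addr0.
rewrite (le_trans (ler_normB _ _))//.
rewrite (le_trans (lerD (boundedOp_le_norm _ _) (boundedOp_le_norm _ _)))//.
rewrite -mulrDl (le_trans (ler_wpM2l _ (ltW mu))) ?addr_ge0//.
by rewrite mulrCA ler_piMr ?(ltW e0)// ler_pdivrMr// mul1r lerDl.
Qed.

Lemma linearization_exists : exists T, is_linearization f T.
Proof.
pose g (m : lipschitz_free) : lipschitz_free :=
  LipschitzFree (pullback_free (valP m)).
have gP : g \in bounded_operator.
  apply/asboolP; split; first by move=> a u v; exact/val_inj/val_inj.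
  by have [k _ pk] := pullback_bound; exists k => m; exact: pk.
by exists (BoundedOp gP) => x; exact/val_inj/val_inj.
Qed.

(* The choice is immaterial by linearization_unique. *)
Definition linearization : boundedOp lipschitz_free lipschitz_free :=
  sval (cid linearization_exists).

Lemma linearizationP x : linearization (delta x) = delta (f x).
Proof. by rewrite /linearization; case: cid. Qed.

End Linearization.

End LipschitzFree.

(* Main.v *)
Require Import Defs.
From mathcomp Require Import all_boot all_order all_algebra.
From mathcomp Require Import all_classical all_reals all_analysis.
From mathcomp Require Import ring lra.
Import Order.TTheory GRing.Theory Num.Theory.
Import numFieldNormedType.Exports.
Local Open Scope classical_set_scope.
Local Open Scope ring_scope.

(** If [gamma] is finitely supported, every multiple of an iterate of [gamma] is
    a combination of the same number [n] of point evaluations, and such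
    combinations stay at positive distance from a sum of [n + 1] evaluations.

    It remains to see that [gamma] lies in the span of its support [S] when [S]
    is finite, that is, that [gamma] annihilates every [phi] vanishing on [S].
    By truncation one may take [phi] bounded with support away from [S]. If
    <phi, gamma> <> 0, multiply [phi] by a partition of unity made of tents of
    radius [r] over a finite set which almost carries [gamma]: the Lipschitz
    constants involved depend on [r] only, so some piece of [phi], supported in a
    ball of radius [r], still pairs nontrivially with [gamma]. Iterating with
    [r -> 0], the supports shrink by completeness to a point outside [S]; but near
    such a point [gamma] vanishes. *)

(** * Truncation of real numbers *)

Section RealClipping.
Context {R : realType}.
Implicit Types e s t : R.

(** This is what makes truncations and tents 1-Lipschitz. *)
Lemma dist_max_le e a b c d :
  `|a - c| <= e -> `|b - d| <= e -> `|Num.max a b - Num.max c d| <= e.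
Proof.
rewrite !ler_norml => /andP[? ?] /andP[? ?].
by apply/andP; split; case: (leP a b) => ?; case: (leP c d) => ?; lra.
Qed.

Definition clip e t := Num.max (- e) (Num.min e t).

Lemma clip_le e t : 0 <= e -> `|clip e t| <= e.
Proof.
move=> e0; rewrite /clip ler_norml le_max lexx/= ge_max ge_min lexx andbT.
lra.
Qed.

Lemma clip_id e t : `|t| <= e -> clip e t = t.
Proof. by rewrite ler_norml /clip => /andP[? /min_r ->]; exact: max_r. Qed.

Lemma clip_dist e s t : `|clip e s - clip e t| <= `|s - t|.
Proof.
apply: dist_max_le; first by rewrite subrr normr0.
(* A minimum is the opposite of a maximum of opposites, so [dist_max_le] applies again. *)
rewrite -[leLHS]normrN -[Num.min e s]opprK -[Num.min e t]opprK !oppr_min -opprD.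
rewrite opprK; apply: dist_max_le; first by rewrite subrr normr0.
by rewrite -opprD normrN.
Qed.

End RealClipping.

(** * Tents over finite sets *)

Section Tent.
Context {R : realType} {M : metricType R}.
Implicit Types (r : R) (x y : M) (s : seq M).

(* [tent r s x] is the positive part of [r - d(x, s)]. *)
Definition tent r s x : R := \big[Num.max/0]_(y <- s) (r - mdist x y).

Lemma tent_nil r x : tent r [::] x = 0.
Proof. by rewrite /tent big_nil. Qed.

Lemma tent_cons r y s x :
  tent r (y :: s) x = Num.max (r - mdist x y) (tent r s x).
Proof. by rewrite /tent big_cons. Qed.

Lemma tent_ge0 r s x : 0 <= tent r s x.
Proof.
elim: s => [|y s IH]; first by rewrite tent_nil.
by rewrite tent_cons le_max IH orbT.
Qed.

Lemma tent_le r s x : 0 <= r -> tent r s x <= r.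
Proof.
move=> r0; elim: s => [|y s IH]; first by rewrite tent_nil.
by rewrite tent_cons ge_max IH gerBl mdist_ge0.
Qed.

Lemma tent_mem r s y : 0 <= r -> y \in s -> tent r s y = r.
Proof.
move=> r0 ys; apply/eqP; rewrite eq_le tent_le//=.
elim: s ys => [//|z s IH]; rewrite inE tent_cons le_max => /predU1P[->|/IH ->].
  by rewrite mdistxx subr0 lexx.
by rewrite orbT.
Qed.

Lemma tent_far r y s x : r <= mdist x y -> tent r (y :: s) x = tent r s x.
Proof.
move=> ry; rewrite tent_cons; apply: max_r.
by rewrite (le_trans _ (tent_ge0 _ _ _))// subr_le0.
Qed.

Lemma mdist_diff_le x y z : `|mdist x z - mdist y z| <= mdist x y.
Proof.
have := metric_triangle x y z; have := metric_triangle y x z.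
by rewrite (metric_sym y x) ler_norml => ? ?; apply/andP; split; lra.
Qed.

Lemma tent_dist r s x y : `|tent r s x - tent r s y| <= mdist x y.
Proof.
elim: s => [|z s IH]; first by rewrite !tent_nil subrr normr0 mdist_ge0.
rewrite !tent_cons; apply: dist_max_le => //.
rewrite [_ - _ - _](_ : _ = - (mdist x z - mdist y z)); last by ring.
by rewrite normrN mdist_diff_le.
Qed.

End Tent.

(** * Duality between the free space and Lipschitz functions *)

Section Pairing.
Context {R : realType} {M : metricType R} {x0 : M}.
Implicit Types (g h : lipschitz_free x0) (phi psi : Lip0 x0) (K : set M).

Lemma Lip0_build (f : M -> R) k : 0 <= k -> f x0 = 0 ->
  (forall x y, `|f x - f y| <= k * mdist x y) ->
  exists2 phi : Lip0 x0, (forall x, phi x = f x) & `|phi| <= k.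
Proof.
move=> k0 f0 fk.
have fP : (f : M -> R^o) \in lip0 x0.
  apply/asboolP; split=> //; exists k => x y.
  by rewrite {1}/mdist/= distrC; exact: fk.
exists (MkLip0 fP) => //.
by apply: best_constant_le; split=> // -[x y]; exact: fk.
Qed.

Lemma Lip0B phi psi x : (phi - psi) x = phi x - psi x :> R.
Proof. by []. Qed.

Lemma Lip0Z a phi x : (a *: phi) x = a * phi x :> R.
Proof. by []. Qed.

Definition pairing g phi : R := free_val g phi.

Lemma pairingB g phi psi : pairing g (phi - psi) = pairing g phi - pairing g psi.
Proof. exact: (linearB (free_val g)). Qed.

Lemma pairing0 g : pairing g 0 = 0.
Proof. exact: (linear0 (free_val g)). Qed.

Lemma pairingZ g a phi : pairing g (a *: phi) = a * pairing g phi.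
Proof. exact: (linearZ_LR (free_val g)). Qed.

Lemma pairing_norm g phi : `|pairing g phi| <= `|g| * `|phi|.
Proof. exact: (boundedOp_le_norm (free_val g)). Qed.

Lemma pairingBl g h phi : pairing (g - h) phi = pairing g phi - pairing h phi.
Proof. by []. Qed.

Lemma pairingZl g a phi : pairing (a *: g) phi = a * pairing g phi.
Proof. by []. Qed.

Lemma pairing_sum n (a : 'I_n -> R) (y : 'I_n -> M) phi :
  pairing (\sum_(i < n) a i *: delta x0 (y i)) phi = \sum_(i < n) a i * phi (y i).
Proof.
elim: n a y => [|n IH] a y; first by rewrite !big_ord0.
by rewrite !big_ord_recl -IH.
Qed.

Lemma pairing_inj g : (forall phi, pairing g phi = 0) -> g = 0.
Proof. by move=> g0; apply/val_inj/val_inj/funext. Qed.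

Lemma lin_span_delta K g : lin_span (delta x0 @` K) g ->
  exists n (a : 'I_n -> R) (y : 'I_n -> M),
    (forall i, K (y i)) /\ g = \sum_(i < n) a i *: delta x0 (y i).
Proof.
move=> [n [a [x [xK ->]]]].
have /choice[y yK] : forall i, exists y, K y /\ delta x0 y = x i.
  by move=> i; have [y Ky yx] := xK i; exists y.
exists n, a, y; split=> [i|]; first by have [] := yK i.
by apply: eq_bigr => i _; have [_ ->] := yK i.
Qed.

Lemma free_on_setT g : free_on [set: M] g.
Proof.
apply/closure_normP => e e0; case: g => m mF.
have /asboolP/closure_normP/(_ _ e0)[_ [n [a [x [xF ->]]]] mu] := mF.
have /choice[y yx] : forall i, exists y, evaluation x0 y = x i.
  by move=> i; have [y] := xF i; exists y.
exists (\sum_(i < n) a i *: delta x0 (y i)).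
  by exists n, a, (delta x0 \o y); split=> // i; exists (y i).
rewrite [ltLHS](_ : _ = `|m - \sum_(i < n) a i *: x i|)//.
congr (`| m - _ |).
rewrite (raddf_sum (val : lipschitz_free x0 -> dual_space (Lip0 x0)))/=.
by apply: eq_bigr => i _; rewrite -yx.
Qed.

(** The combination is fixed before [phi], so test functions may depend on the points [y i]. *)
Lemma free_on_approx K g e : free_on K g -> 0 < e ->
  exists n (a : 'I_n -> R) (y : 'I_n -> M), (forall i, K (y i)) /\
    forall phi, `|pairing g phi - \sum_(i < n) a i * phi (y i)| <= e * `|phi|.
Proof.
move=> /closure_normP gK e0.
have [_ /lin_span_delta[n [a [y [yK ->]]]] gu] := gK _ e0.
exists n, a, y; split=> // phi; rewrite -pairing_sum -pairingBl.
by rewrite (le_trans (pairing_norm _ _))// ler_wpM2r// ltW.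
Qed.

Lemma free_on_vanish K g phi : free_on K g -> (forall x, K x -> phi x = 0) ->
  pairing g phi = 0.
Proof.
move=> gK phi0; apply/eqP; rewrite -normr_le0; apply/ler_addgt0Pr => e e0.
have p1 : 0 < `|phi| + 1 by rewrite ltr_wpDl.
have [n [a [y [yK /(_ phi)]]]] := free_on_approx _ _ _ gK (divr_gt0 e0 p1).
rewrite big1 ?subr0 => [/le_trans->//|i _]; last by rewrite phi0 ?mulr0.
by rewrite add0r mulrAC ler_pdivrMr// ler_wpM2l ?ltW// ltrDl.
Qed.

(** Induction on [s]: if some [u] vanishing on [s] pairs nontrivially with [g], then [u x != 0], and
    subtracting the multiple of [delta x0 x] that makes [g] kill [u] removes the point [x]. *)
Lemma span_of_vanish (s : seq M) g :
  (forall phi, (forall x, x \in s -> phi x = 0) -> pairing g phi = 0) ->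
  finitely_supported g.
Proof.
elim: s g => [|x s IH] g gs.
  rewrite (_ : g = 0); first exact: span0.
  by apply: pairing_inj => phi; exact: gs.
have [sg|/existsNP[u /not_implyP[us /eqP gu]]] := pselect
    (forall phi, (forall x, x \in s -> phi x = 0) -> pairing g phi = 0).
  exact: IH.
have ux : u x != 0.
  apply: contraNneq gu => ux; apply/eqP/gs => z.
  by rewrite inE => /predU1P[->|/us].
pose c : R := pairing g u / u x.
rewrite -[g](subrK (c *: delta x0 x)) addrC; apply: spanZD.
  by apply: Defs.sub_span; exists x.
apply: IH => phi phis; rewrite pairingBl pairingZl.
have -> : pairing (delta x0 x) phi = phi x by [].
(* Correcting [phi] by a multiple of [u] makes it vanish at [x] as well as on [s]. *)
have : pairing g (phi - (phi x / u x) *: u) = 0.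
  apply: gs => z; rewrite inE => /predU1P[->|zs].
    by rewrite Lip0B Lip0Z divfK ?subrr.
  by rewrite Lip0B Lip0Z (phis z zs) (us z zs) mulr0 subr0.
by rewrite pairingB pairingZ => <-; rewrite /c; ring.
Qed.

End Pairing.

(** * Annihilation of functions vanishing on the support *)

Section Support.
Context {R : realType} {M : completeMetricType R} {x0 : M}.
Implicit Types (g : lipschitz_free x0) (phi psi : Lip0 x0).

(** Leibniz estimate: a tent is bounded by [r] and 1-Lipschitz whatever [s] is. *)
Lemma Lip0_mul_tent phi B r s : (forall x, `|phi x| <= B) -> 0 <= r ->
  exists2 psi : Lip0 x0, (forall x, psi x = phi x * tent r s x) &
    `|psi| <= `|phi| * r + B.
Proof.
move=> phiB r0; have B0 : 0 <= B by rewrite (le_trans _ (phiB x0)).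
apply: Lip0_build; first by rewrite addr_ge0// mulr_ge0.
  by rewrite Lip0_base mul0r.
move=> x y; rewrite [_ - _](_ : _ =
  (phi x - phi y) * tent r s x + phi y * (tent r s x - tent r s y)); last by ring.
rewrite (le_trans (ler_normD _ _))// [leRHS]mulrDl !normrM; apply: lerD.
  rewrite mulrAC; apply: ler_pM => //; first exact: Lip0_le_norm.
  by rewrite ger0_norm ?tent_ge0// tent_le.
by apply: ler_pM => //; exact: tent_dist.
Qed.

(* The partial products [phi * tent r s] telescope when [s] grows, and each
   increment lives in one ball of radius [r]. *)
Lemma pairing_localize_tent g phi psi B r s :
  (forall x, `|phi x| <= B) -> 0 < r ->
  (forall x, psi x = phi x * tent r s x) -> pairing g psi != 0 ->
  exists psi' : Lip0 x0, [/\ forall x, `|psi' x| <= B * r, pairing g psi' != 0 &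
    exists y, forall x, psi' x != 0 -> phi x != 0 /\ mdist x y < r].
Proof.
move=> phiB r0; have r0' := ltW r0.
elim: s psi => [|y s IH] psi psiE gpsi.
  suff psi0 : psi = 0 by move: gpsi; rewrite psi0 pairing0 eqxx.
  by apply/val_inj/funext => x; rewrite /= psiE tent_nil mulr0.
have [chi chiE _] := Lip0_mul_tent phi B r s phiB r0'.
(* If the shorter product [chi] pairs to zero, the increment [psi - chi] carries the whole
   pairing. *)
have [gchi|gchi] := eqVneq (pairing g chi) 0; last exact: IH gchi.
have dE x : (psi - chi) x = phi x * (tent r (y :: s) x - tent r s x).
  by rewrite Lip0B mulrBr psiE chiE.
exists (psi - chi); split.
- move=> x; rewrite dE normrM; apply: ler_pM => //.
  have := tent_ge0 r s x; have := tent_le r (y :: s) x r0'.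
  have := tent_ge0 r (y :: s) x; have := tent_le r s x r0'.
  by rewrite ler_norml => ????; apply/andP; split; lra.
- by rewrite pairingB gchi subr0.
- exists y => x; rewrite dE mulf_eq0 negb_or subr_eq0 => /andP[phix].
  by case: (ltP (mdist x y) r) => // /tent_far->; rewrite eqxx.
Qed.

(* [r *: phi] and [phi * tent r s] agree on [s], and the norm of their difference
   does not depend on [s]: taking for [s] the support of a good enough finitely
   supported approximation of [g] makes the two pairings as close as desired. *)
Lemma pairing_localize g phi B r : (forall x, `|phi x| <= B) -> 0 < r ->
  pairing g phi != 0 ->
  exists psi : Lip0 x0, [/\ forall x, `|psi x| <= B * r, pairing g psi != 0 &
    exists y, forall x, psi x != 0 -> phi x != 0 /\ mdist x y < r].
Proof.
move=> phiB r0 gphi.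
pose N := r * `|phi| + (`|phi| * r + B).
have B0 : 0 <= B by rewrite (le_trans _ (phiB x0)).
have N0 : 0 <= N by rewrite !addr_ge0// mulr_ge0// ltW.
have c0 : 0 < r * `|pairing g phi| by rewrite mulr_gt0// normr_gt0.
have e0 : 0 < r * `|pairing g phi| / (N + 1) by rewrite divr_gt0// ltr_wpDl.
have [n [a [y [_ ga]]]] := free_on_approx _ _ _ (free_on_setT g) e0.
have [psi psiE psiN] := Lip0_mul_tent phi B r (codom y) phiB (ltW r0).
apply: (pairing_localize_tent g phi psi B r (codom y)) => //.
apply/eqP => gpsi; have := ga (r *: phi - psi); rewrite pairingB gpsi subr0.
rewrite big1 => [|i _]; last first.
  rewrite Lip0B Lip0Z psiE tent_mem ?ltW//.
    by rewrite [r * _]mulrC subrr mulr0.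
  exact: codom_f.
rewrite subr0 pairingZ normrM gtr0_norm// leNgt => /negP; apply.
have dN : `|r *: phi - psi| <= N.
  rewrite (le_trans (ler_normB _ _))// normrZ gtr0_norm//.
  by rewrite lerD2l.
rewrite (le_lt_trans (ler_wpM2l (ltW e0) dN))// mulrAC ltr_pdivrMr ?ltr_wpDl//.
by rewrite ltr_pM2l// ltrDl.
Qed.

Definition locally_null g x := exists2 r : R, 0 < r &
  forall phi, (forall y, phi y != 0 -> mdist x y < r) -> pairing g phi = 0.

Lemma pairing_locally_null g phi B : (forall x, `|phi x| <= B) ->
  (forall x, closure [set y | phi y != 0] x -> locally_null g x) ->
  pairing g phi = 0.
Proof.
move=> phiB gnull; apply/eqP/negPn/negP => gphi.
(* States of the iteration; a bound is kept since every localization requires one. *)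
pose T := {psi : Lip0 x0 | (exists C, forall x, `|psi x| <= C) /\
  pairing g psi != 0}.
have /choice[next nextP] : forall p : T * nat, exists p' : T, exists y,
    forall x, sval p' x != 0 -> sval p.1 x != 0 /\ mdist x y < p.2.+1%:R^-1.
  move=> [[psi [[C psiC] gpsi]] n] /=.
  have n0 : 0 < n.+1%:R^-1 :> R by rewrite invr_gt0.
  have [psi' [psi'C gpsi' [y psiy]]] := pairing_localize g psi C _ psiC n0 gpsi.
  by exists (exist _ psi' (conj (ex_intro _ _ psi'C) gpsi')); exists y.
pose u := fix u n : T := if n is m.+1 then next (u m, m) else
  exist _ phi (conj (ex_intro _ _ phiB) gphi).
pose S n := [set x | sval (u n) x != 0].
have /choice[y Sy] : forall n, exists y, forall x, S n.+1 x ->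
    S n x /\ mdist x y < n.+1%:R^-1.
  by move=> n; exact: (nextP (u n, n)).
have S_dec m n : (m <= n)%N -> S n `<=` S m.
  move=> /subnK <-; elim: (n - m)%N => [//|k IH] x.
  by rewrite addSn => /Sy[/IH].
(* An empty [S n.+1] would mean a zero function, which pairs to zero. *)
have /choice[z Sz] : forall n, exists z, S n.+1 z.
  move=> n; apply: contrapT => /forallNP Sn.
  have [_ /eqP[]] := svalP (u n.+1).
  rewrite (_ : sval (u n.+1) = 0) ?pairing0//.
  by apply/val_inj/funext => x; have /negP/negPn/eqP := Sn x.
have small e : 0 < e -> exists N, N.+1%:R^-1 < e :> R.
  by move=> e0; have [N _ /(_ _ (leqnn N))] := near_infty_natSinv_lt (PosNum e0);
    exists N.
have zy N n : (N <= n)%N -> mdist (z n) (y N) < N.+1%:R^-1.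
  by move=> Nn; have [] := Sy N (z n) (S_dec N.+1 n.+1 Nn _ (Sz n)).
have z_cvg : cvg (z @ \oo).
  apply: cauchy_cvg; apply: cauchy_exP => e /small[N Ne].
  exists (y N), N => // n /= Nn; rewrite ballEmdist/= metric_sym.
  by rewrite (lt_trans (zy _ _ Nn)).
set x := lim (z @ \oo) in z_cvg.
have xz e : 0 < e -> exists N, forall n, (N <= n)%N -> mdist x (z n) < e.
  move=> e0; have [N _ Nz] := z_cvg _ (nbhsx_ballx x e e0).
  by exists N => n /Nz; rewrite /= ballEmdist.
(* All [z n] lie in [S 0], so their limit [x] is in the closure of the set where [phi] is
   nonzero. *)
have [|r r0 rnull] := gnull x.
  move=> U /z_cvg[N _ NU]; exists (z N); split; last exact: (NU N (leqnn N)).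
  exact: (S_dec 0%N N.+1 _ _ (Sz N)).
(* Going from [x] to [w] through some [z n] and [y N2] costs less than three quarters of [r]. *)
have r4 : 0 < r / 4 by rewrite divr_gt0.
have [N1 zN1] := xz _ r4; have [N2 N2r] := small _ r4.
have [_ /eqP] := svalP (u N2.+1); apply; apply: rnull => w /Sy[_ wy].
have xzN := zN1 (maxn N1 N2) (leq_maxl _ _).
have zyN := zy N2 (maxn N1 N2) (leq_maxr _ _).
have := metric_triangle x (z (maxn N1 N2)) w.
have := metric_triangle (z (maxn N1 N2)) (y N2) w.
rewrite (metric_sym (y N2) w) => ? ?.
by have := lt_trans zyN N2r; have := lt_trans wy N2r => ? ?; lra.
Qed.

(** Some closed [K] with [g] in F(K) misses [x], hence misses a ball around it; functions living in
    that ball vanish on [K]. *)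
Lemma locally_null_outside_support g x : ~ free_support g x -> locally_null g x.
Proof.
move=> /existsNP[K /not_implyP[[Kcl _ gK] Kx]].
have /nbhs_ballP[r r0 rK] : nbhs x (~` K).
  by apply: open_nbhs_nbhs; split=> //; exact: closed_openC.
exists r => // phi phir; apply: (free_on_vanish _ _ _ gK) => y Ky.
apply/eqP/negPn/negP => /phir yx; apply: (rK y) => //.
by rewrite ballEmdist.
Qed.

(* Truncating [phi] at heights [eta] and [b] leaves a bounded function whose
   support avoids the zeros of [phi]. *)
Lemma Lip0_truncation phi (eta b : R) : 0 < eta -> eta <= b ->
  exists psi : Lip0 x0, [/\ forall x, psi x = clip b (phi x) - clip eta (phi x),
    `|psi| <= 2 * `|phi| & forall x, closure [set y | psi y != 0] x -> phi x != 0].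
Proof.
move=> eta0 etab.
have psi_small x : `|phi x| <= eta -> clip b (phi x) - clip eta (phi x) = 0.
  by move=> phix; rewrite !clip_id ?subrr// (le_trans phix).
have [||x y|psi psiE psiN] :=
    @Lip0_build R M x0 (fun x => clip b (phi x) - clip eta (phi x)) (2 * `|phi|).
- by rewrite mulr_ge0.
- by rewrite psi_small// Lip0_base normr0 ltW.
- rewrite [X in `|X|](_ : _ = (clip b (phi x) - clip b (phi y)) -
    (clip eta (phi x) - clip eta (phi y))); last by ring.
  rewrite (le_trans (ler_normB _ _))// -mulrA mulr_natl mulr2n.
  by apply: lerD; rewrite (le_trans (clip_dist _ _ _))// Lip0_le_norm.
exists psi; split=> // x psix; apply/eqP => phix.
(* Within [eta / (|phi| + 1)] of a zero of [phi], one has [|phi| <= eta], where both truncations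
   agree. *)
have p1 : 0 < `|phi| + 1 by rewrite ltr_wpDl.
have [y [/= /eqP psiy]] := psix _ (nbhsx_ballx x _ (divr_gt0 eta0 p1)).
rewrite ballEmdist/= ltr_pdivlMr// => xy; apply: psiy.
rewrite psiE psi_small// -[phi y]subr0 -phix distrC.
rewrite (le_trans (Lip0_le_norm _ _ _))// (le_trans _ (ltW xy))// mulrC.
by rewrite ler_wpM2l ?mdist_ge0// lerDl.
Qed.

Lemma pairing_support_vanish g phi :
  (forall x, free_support g x -> phi x = 0) -> pairing g phi = 0.
Proof.
move=> phi0; apply/eqP; rewrite -normr_le0; apply/ler_addgt0Pr => e e0.
rewrite add0r.
(* Half of [e] pays for approximating [g], tested on [phi - psi] of norm at most [3 * |phi|]. *)
pose d := e / (3 * `|phi| + 1) / 2.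
have p1 : 0 < 3 * `|phi| + 1 by rewrite ltr_wpDl// mulr_ge0.
have d0 : 0 < d by rewrite !divr_gt0.
have [n [a [y [_ ga]]]] := free_on_approx _ _ _ (free_on_setT g) d0.
pose A := \sum_(i < n) `|a i| + 1.
have A0 : 0 < A by rewrite ltr_wpDl// sumr_ge0.
(* The other half: as [b] exceeds every [|phi (y i)|], [phi - psi] is [clip eta phi] at the [y i],
   of size at most [eta]. *)
pose eta := e / 2 / A; have eta0 : 0 < eta by rewrite !divr_gt0.
pose b := \sum_(i < n) `|phi (y i)| + eta.
have phib i : `|phi (y i)| <= b.
  by rewrite /b (bigD1 i)//= -addrA lerDl addr_ge0 ?(ltW eta0)// sumr_ge0.
have etab : eta <= b by rewrite lerDr sumr_ge0.
have [psi [psiE psiN psi_supp]] := Lip0_truncation phi eta b eta0 etab.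
have gpsi : pairing g psi = 0.
  apply: (pairing_locally_null g psi (b + eta)).
    move=> x; rewrite psiE (le_trans (ler_normB _ _))// lerD// clip_le//.
      exact: le_trans (ltW eta0) etab.
    exact: ltW.
  move=> x /psi_supp phix; apply: locally_null_outside_support => /phi0 phix0.
  by rewrite phix0 eqxx in phix.
have := ga (phi - psi); rewrite pairingB gpsi subr0.
have dN : `|phi - psi| <= 3 * `|phi|.
  by rewrite (le_trans (ler_normB _ _))//; lra.
have small : d * (3 * `|phi|) <= e / 2.
  rewrite /d mulrAC ler_pM2r// mulrAC ler_pdivrMr// ler_pM2l// lerDl.
  exact: ler01.
set s := \sum_(i < n) _ => gs.
have sA : `|s| <= e / 2.
  rewrite /s (le_trans (ler_norm_sum _ _ _))//.
  rewrite (@le_trans _ _ (\sum_(i < n) `|a i| * eta))//; last first.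
    rewrite -mulr_suml /eta mulrA ler_pdivrMr// mulrC ler_pM2l ?divr_gt0//.
    by rewrite /A lerDl.
  apply: ler_sum => i _; rewrite normrM ler_wpM2l//.
  rewrite Lip0B psiE (clip_id b)//.
  by rewrite opprB addrC subrK clip_le// ltW.
have := ler_normD (pairing g phi - s) s; rewrite subrK.
by have := ler_wpM2l (ltW d0) dN => ? ?; lra.
Qed.

End Support.

(** * Combinations of few evaluations, and supercyclicity *)

Section FewPoints.
Context {R : realType} {M : metricType R} {x0 : M}.

Lemma separation_radius n (p : 'I_n -> M) : injective p -> (forall i, p i != x0) ->
  exists r : R, [/\ 0 < r, forall i, r <= mdist x0 (p i) &
    forall i j, i != j -> r + r <= mdist (p i) (p j)].
Proof.
move=> pinj px0.
(* Diagonal pairs encode distances to the base point, so a single minimum gives both bounds. *)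
pose F (k : 'I_n * 'I_n) := if k.1 == k.2 then mdist x0 (p k.1)
  else mdist (p k.1) (p k.2) / 2.
have F0 k : 0 < F k.
  rewrite /F; case: eqP => [_|/eqP ij]; first by rewrite mdist_gt0 eq_sym.
  by rewrite divr_gt0// mdist_gt0 (inj_eq pinj).
exists (\big[Num.min/1]_k F k); split.
- by apply: lt_bigmin.
- by move=> i; rewrite (le_trans (bigmin_le _ (i, i) _))// /F eqxx.
- move=> i j /negbTE ij; rewrite -mulr2n -mulr_natr -ler_pdivlMr//.
  by rewrite (le_trans (bigmin_le _ (i, j) _))// /F /= ij.
Qed.

(* Pigeonhole: each of the [n] points [y i] meets at most one of the [n.+1]
   disjoint balls of radius [r] around the [p j], so the tent over one of these
   balls does not see [y]. *)
Lemma dist_sum_delta n (p : 'I_n.+1 -> M) : injective p ->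
  (forall i, p i != x0) -> exists2 r : R, 0 < r &
  forall (a : 'I_n -> R) (y : 'I_n -> M),
    r <= `|\sum_(j < n.+1) 1 *: delta x0 (p j) -
         \sum_(i < n) a i *: delta x0 (y i)|.
Proof.
move=> pinj px0; have [r [r0 rx0 rp]] := separation_radius _ _ pinj px0.
exists r => // a y.
have [j jy] : exists j, forall i, r <= mdist (y i) (p j).
  apply: contrapT => /forallNP noj.
  have /choice[h hy] : forall j, exists i, mdist (y i) (p j) < r.
    move=> j; have /existsNP[i yi] := noj j.
    by exists i; rewrite ltNge; apply/negP.
  have : (#|'I_n.+1| <= #|'I_n|)%N.
    apply: (leq_card h) => j k hjk; apply/eqP/negPn/negP => /rp.
    rewrite leNgt => /negP; apply.
    rewrite (le_lt_trans (metric_triangle _ (y (h j)) _))// ltrD//.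
      by rewrite metric_sym.
    by rewrite hjk.
  by rewrite !card_ord ltnn.
have tent0 x : r <= mdist x (p j) -> tent r [:: p j] x = 0.
  by move=> ?; rewrite tent_far// tent_nil.
have [|x z|b bE bN] := @Lip0_build R M x0 (tent r [:: p j]) 1 ler01.
- exact: tent0.
- by rewrite mul1r tent_dist.
set w := _ - _.
have wb : pairing w b = r.
  rewrite pairingBl !pairing_sum [X in _ - X]big1 => [|i _]; last first.
    by rewrite bE tent0 ?mulr0.
  rewrite subr0 (bigD1 j)//= big1 => [|k kj]; last first.
    by rewrite bE tent0 ?mulr0// (le_trans _ (rp _ _ kj))// lerDl ltW.
  by rewrite addr0 mul1r bE tent_mem ?inE// ltW.
rewrite -(gtr0_norm r0) -[X in `|X| <= _]wb (le_trans (pairing_norm _ _))//.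
by rewrite ler_piMr.
Qed.

Lemma supercyclic_infinitely_supported (f : M -> M)
    (T : boundedOp (lipschitz_free x0) (lipschitz_free x0)) g :
  infinite_set [set: M] -> is_linearization f T -> supercyclic T g ->
  infinitely_supported g.
Proof.
move=> Minf Tf gT /lin_span_delta[n [a [y [_ gE]]]].
have : infinite_set ([set: M] `\` [set x0]) by exact: infinite_setD.
move=> /infiniteP/card_leP[p].
(* One point more than the [n] atoms of [g], all distinct and away from [x0]. *)
pose q (i : 'I_n.+1) : M := set_val (p (to_setT (i : nat))).
have [||r r0 rP] := @dist_sum_delta n q.
- move=> i j /val_inj; rewrite /= => ij; apply/val_inj.
  by have := inj (in_setT _) (in_setT _) ij => -[].
- by move=> i; have [_ /eqP] := set_valP (p (to_setT (i : nat))).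
have iterE k : iter k T g = \sum_(i < n) a i *: delta x0 (iter k f (y i)).
  elim: k => [//|k IH]; rewrite iterS IH linear_sum; apply: eq_bigr => i _.
  by rewrite linearZ/= Tf.
pose w := \sum_(j < n.+1) 1 *: delta x0 (q j).
(* Density puts some [l *: iter k T g] within [r] of [w], which [rP] forbids. *)
have [u [wu [l [k uE]]]] :=
  gT (ball w r) (ex_intro _ w (ballxx w r0)) (ball_open w r).
move: wu; rewrite -ball_normE/= uE ltNge => /negP; apply.
rewrite iterE scaler_sumr; under [X in _ - X]eq_bigr do rewrite scalerA.
exact: rP.
Qed.

End FewPoints.

Theorem proposition2p9 (R : realType) (M : completeMetricType R) (x0 : M)
    (M_infinite : infinite_set [set: M])
    (f : M -> M) (f_lip : lipschitz_map f) (f0 : f x0 = x0)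
    (gamma : lipschitz_free x0)
    (gamma_supercyclic : supercyclic (linearization f_lip f0) gamma) :
  infinitely_supported gamma /\ infinite_set (free_support gamma).
Proof.
have gamma_inf : infinitely_supported gamma.
  apply: supercyclic_infinitely_supported gamma_supercyclic => //.
  exact: linearizationP.
split=> // /finite_seqP[s sE]; apply: gamma_inf; apply: (span_of_vanish s).
by move=> phi phis; apply: pairing_support_vanish => x; rewrite sE => /phis.
Qed.
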